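(* Let $n\geq 1$ be an integer and put $r=\left\lfloor \frac{\sqrt{4n+1}+1}{2}\right\rfloor$. Then every attainable partition of $n$ has length at most $r$. Moreover, this bound is realized by the partition $\lambda=(n-r+1,1,\dots,1)$ of $n$ (with $r-1$ parts equal to $1$), which satisfies $0\leq c(\lambda)<\sqrt{4n+1}$.
   Context: A partition of a positive integer $n$ is a tuple $\lambda=(n_1,n_2,\dots,n_r)$ of positive integers with $n_1\geq n_2\geq\dots\geq n_r$ and $n_1+\dots+n_r=n$; $r$ is its length. The cyclicity index of $\lambda$ is $c(\lambda)=\sum_{i=1}^r(3-2i)n_i$. The partition $\lambda$ is called attainable if $c(\lambda)\geq 0$. *)

(* Defs.v *)
From mathcomp Require Import all_boot all_order all_algebra.
From mathcomp Require Import reals.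
Set Implicit Arguments.
Unset Strict Implicit.
Unset Printing Implicit Defensive.
Import Order.TTheory GRing.Theory Num.Theory.

Local Open Scope ring_scope.

Definition is_partition (n : nat) (s : seq nat) : bool :=
  [&& sorted geq s, all (fun m => 0 < m)%N s & sumn s == n].

(* The part n_i, numbered from i = 1, is [nth 0%N s i.-1]; the coefficient
   3 - 2 i is computed in [int], so it is negative for i > 1. *)
Definition cyclicity_index (s : seq nat) : int :=
  \sum_(1 <= i < (size s).+1) (3%:Z - 2%:Z * i%:Z) * (nth 0%N s i.-1)%:Z.

Definition attainable (s : seq nat) : bool := 0 <= cyclicity_index s.

(* Main.v *)
(** Since [3 - 2 i = 1 - 2 (i - 1)] and all parts are at least 1, a partition of
    [n] of length [k] has cyclicity index at most [n - k (k - 1)], with equality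
    when all parts but the first are 1. Hence the largest attainable length is
    the largest [r] with [r (r - 1) <= n], that is [(2 r - 1)^2 <= 4 n + 1]. *)
Require Import Defs.
From mathcomp Require Import all_boot all_order all_algebra.
From mathcomp Require Import reals.
From mathcomp Require Import zify ring lra.
Set Implicit Arguments.
Unset Strict Implicit.
Unset Printing Implicit Defensive.
Import Order.TTheory GRing.Theory Num.Theory.

Local Open Scope ring_scope.

(** Counting positions from [0] turns the coefficient into [1 - 2 i]. The weighted sum then stays in
    [nat], where it can be compared term by term. *)
Lemma cyclicity_indexE (s : seq nat) :
  cyclicity_index s =
  (sumn s)%:Z - (2 * \sum_(i < size s) i * nth 0%N s i)%N%:Z.
Proof.
rewrite /cyclicity_index big_add1 /= big_mkord sumnE (big_nth 0%N) big_mkord.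
elim: (size s) => [|k IHk]; first by rewrite !big_ord0.
rewrite !big_ord_recr /= {}IHk.
rewrite mulnDr !PoszD !PoszM intS; ring.
Qed.

Lemma double_sum_ord (k : nat) : (2 * \sum_(i < k) i = k * k.-1)%N.
Proof.
elim: k => [|k IHk]; first by rewrite big_ord0.
rewrite big_ord_recr /= mulnDr IHk; case: k {IHk} => //= k; nia.
Qed.

Lemma cyclicity_index_le (s : seq nat) : all (fun m => 0 < m)%N s ->
  cyclicity_index s <= (sumn s)%:Z - (size s * (size s).-1)%N%:Z.
Proof.
move=> /all_nthP s_gt0; rewrite cyclicity_indexE lerD2l lerN2 lez_nat.
rewrite -double_sum_ord leq_mul2l /=; apply: leq_sum => i _.
by rewrite leq_pmulr // s_gt0.
Qed.

Lemma cyclicity_index_hook (a k : nat) :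
  cyclicity_index (a :: nseq k 1%N) = (a + k)%N%:Z - (k.+1 * k)%N%:Z.
Proof.
rewrite cyclicity_indexE /= size_nseq sumn_nseq mul1n.
rewrite -[in RHS](double_sum_ord k.+1); congr (_ - (2 * _)%N%:Z).
(* Position [0] has weight [0], so the first part [a] drops out whatever its value. *)
apply: eq_bigr => -[[|i] ltik] _ //=.
by rewrite nth_nseq (ltik : (i < k)%N) muln1.
Qed.

(** The floor condition says [2 r - 1 <= sqrt (4 n + 1) < 2 r + 1]; squaring both sides removes the
    root. *)
Lemma floor_sqrt_bounds (R : realType) (n r : nat) :
  r%:Z = Num.floor ((Num.sqrt (4 * n%:R + 1 : R) + 1) / 2) ->
  (r * r.-1 <= n < r * r.+1)%N.
Proof.
move=> hr; set x : R := 4 * n%:R + 1.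
have x_ge0 : 0 <= x by rewrite addr_ge0 ?mulr_ge0.
have := floor_itv ((Num.sqrt x + 1) / 2).
rewrite -hr intrD -!pmulrn => /andP[le_r gt_r].
have s_ge0 := sqrtr_ge0 x; have := sqr_sqrtr x_ge0.
move: s_ge0 le_r gt_r; move: (Num.sqrt x : R) => s s_ge0 le_r gt_r.
rewrite /x => sqr_s.
have ltn : (n%:R : R) < (r * r.+1)%:R.
  have r_ge0 : 0 <= (r%:R : R) by [].
  have : s ^+ 2 < (2 * r%:R + 1) ^+ 2 by rewrite ltr_pXn2r ?nnegrE //; lra.
  by rewrite natrM -natr1; nra.
rewrite ltr_nat in ltn; rewrite ltn andbT.
(* Squaring the lower bound needs [2 r - 1 >= 0], hence [r = k + 1]; for [r = 0] the product is
   [0]. *)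
case: r {hr ltn gt_r} le_r => // k; rewrite -(natr1 k) => le_r.
have k_ge0 : 0 <= (k%:R : R) by [].
have : (2 * k%:R + 1) ^+ 2 <= s ^+ 2 by rewrite ler_pXn2r ?nnegrE //; lra.
by rewrite -(ler_nat R) natrM -(natr1 k) /=; nra.
Qed.

Theorem theorem1p3 (R : realType) (n r : nat) (hn : (1 <= n)%N)
    (hr : r%:Z = Num.floor ((Num.sqrt (4 * n%:R + 1 : R) + 1) / 2)) :
  (forall s : seq nat, is_partition n s -> attainable s -> (size s <= r)%N) /\
  (let lam : seq nat := (n - r + 1)%N :: nseq (r - 1)%N 1%N in
   [/\ is_partition n lam,
       attainable lam,
       size lam = r,
       0 <= cyclicity_index lam
     & (cyclicity_index lam)%:~R < Num.sqrt (4 * n%:R + 1 : R)]).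
Proof.
have /andP[ler ltr] := floor_sqrt_bounds hr; split=> [s|lam].
  move=> /and3P[_ s_gt0 /eqP sum_s]; rewrite /attainable => c_ge0.
  have := le_trans c_ge0 (cyclicity_index_le s_gt0); rewrite sum_s.
  rewrite subr_ge0 lez_nat => le_n; rewrite leqNgt; apply/negP => lt_r.
  (* A length of at least [r + 1] would force [(r + 1) r <= n]. *)
  suff : (r * r.+1 <= n)%N by rewrite leqNgt ltr.
  by apply: leq_trans le_n; rewrite mulnC leq_mul // -ltnS prednK // (leq_trans _ lt_r).
case: r {hr} ler ltr @lam => [|k] ler ltr lam; first by rewrite mul0n in ltr.
rewrite /= in ler.
(* Ensures that the subtraction [n - r] in the first part is not truncated. *)
have len : (k.+1 <= n)%N by case: k ler {ltr lam} => // k; nia.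
have c_lam : cyclicity_index lam = (n - k.+1 * k)%N%:Z.
  by rewrite /lam subn1 /= cyclicity_index_hook -subzn //; congr (_%:Z - _); lia.
have c_ge0 : 0 <= cyclicity_index lam by rewrite c_lam.
split=> //; rewrite ?c_lam /lam ?subn1 /= ?size_nseq //.
  apply/and3P; split; rewrite /= ?sumn_nseq ?all_nseq ?addn1 ?orbT //.
    by case: k {ler ltr lam c_lam c_ge0 len} => //= k; elim: k => //= k ->.
  by apply/eqP; lia.
rewrite -pmulrn.
(* With [c = n - k (k + 1)], [c <= 2 k + 1] gives [c^2 <= (2 k + 1)^2 <= 4 n + 1],
   and the last inequality is strict unless [c = 0]. *)
have : ((n - k.+1 * k) ^ 2 < 4 * n + 1)%N.
  (* From [n < (k + 1) (k + 2)], as [(k + 1) (k + 2) - (k + 1) k = 2 k + 2]. *)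
  have : (n - k.+1 * k <= 2 * k + 1)%N by lia.
  have : (n = (n - k.+1 * k) + k.+1 * k)%N by rewrite subnK.
  move: (n - k.+1 * k)%N => c -> {ler ltr lam c_lam c_ge0 len hn}; nia.
rewrite -(ltr_nat R) natrX natrD natrM => lt_c.
by rewrite -[ltLHS]ger0_norm // -sqrtr_sqr ltr_sqrt // (le_lt_trans _ lt_c) ?sqr_ge0.
Qed.
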